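(* Let $n$ be a non-negative integer and $s$ any integer. Then \[ \sum_{j = 0}^n \frac{F_{3j + s - n}}{\binom nj} = \frac{n + 1}{2^{n + 1}}\sum_{j = 0}^n \frac{2^j}{j + 1}(F_{s + 2j + 1} + F_{s - j - 2}), \qquad \sum_{j = 0}^n \frac{L_{3j + s - n}}{\binom nj} = \frac{n + 1}{2^{n + 1}}\sum_{j = 0}^n \frac{2^j}{j + 1}(L_{s + 2j + 1} + L_{s - j - 2}), \] \[ \sum_{j = 0}^n \frac{( - 1)^j F_{3j + s - 2n}}{\binom nj} = \frac{n + 1}{2^{n + 1}}\sum_{j = 0}^n \frac{2^j ( - 1)^j}{j + 1}\left(F_{s + j + 2} + ( - 1)^{j - 1} F_{s - 2j - 1}\right), \] \[ \sum_{j = 0}^n \frac{( - 1)^j L_{3j + s - 2n}}{\binom nj} = \frac{n + 1}{2^{n + 1}}\sum_{j = 0}^n \frac{2^j ( - 1)^j}{j + 1}\left(L_{s + j + 2} + ( - 1)^{j - 1} L_{s - 2j - 1}\right). \]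
   Context: $F_j$ and $L_j$ denote the Fibonacci and Lucas numbers, defined for all integers $j$ by $F_0=0$, $F_1=1$, $L_0=2$, $L_1=1$, $F_j=F_{j-1}+F_{j-2}$, $L_j=L_{j-1}+L_{j-2}$, extended to negative indices by $F_{-j}=(-1)^{j-1}F_j$, $L_{-j}=(-1)^jL_j$; equivalently $F_j=(\alpha^j-\beta^j)/\sqrt5$, $L_j=\alpha^j+\beta^j$ with $\alpha=(1+\sqrt5)/2$, $\beta=(1-\sqrt5)/2$. *)

(* Defs.v *)
From mathcomp Require Import all_boot all_order all_algebra.

Set Implicit Arguments.
Unset Strict Implicit.
Unset Printing Implicit Defensive.

Import GRing.Theory Num.Theory.

Local Open Scope ring_scope.

Fixpoint fib (n : nat) : nat :=
  match n with
  | 0 => 0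
  | 1 => 1
  | (n'.+1 as m).+1 => (fib m + fib n')%N
  end.

Fixpoint lucas (n : nat) : nat :=
  match n with
  | 0 => 2
  | 1 => 1
  | (n'.+1 as m).+1 => (lucas m + lucas n')%N
  end.

(* [Negz n] is the integer -(n+1), so F_{-k} = (-1)^(k-1) F_k and
   L_{-k} = (-1)^k L_k are used with k = n+1. *)
Definition fibz (j : int) : int :=
  match j with
  | Posz n => (fib n)%:Z
  | Negz n => (-1) ^+ n * (fib n.+1)%:Z
  end.

Definition lucasz (j : int) : int :=
  match j with
  | Posz n => (lucas n)%:Z
  | Negz n => (-1) ^+ n.+1 * (lucas n.+1)%:Z
  end.

Definition Fq (j : int) : rat := (fibz j)%:~R.
Definition Lq (j : int) : rat := (lucasz j)%:~R.

Lemma fibz_rec (j : int) : fibz j = fibz (j - 1) + fibz (j - 2).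
Proof.
case: j => [[|[|n]]|n] //.
- have -> : n.+2%:Z - 1 = n.+1%:Z by rewrite -[n.+2]addn1 PoszD addrK.
  have -> : n.+2%:Z - 2 = n%:Z by rewrite -[n.+2]addn2 PoszD addrK.
  by rewrite -PoszD.
have -> : Negz n - 1 = Negz n.+1.
  by rewrite !NegzE -[n.+2]addn1 PoszD -opprD.
have -> : Negz n - 2 = Negz n.+2.
  by rewrite !NegzE -[n.+3]addn2 PoszD -opprD.
rewrite /fibz -[fib n.+3]/(fib n.+2 + fib n.+1)%N PoszD !exprS !mulN1r opprK.
by rewrite mulrDr mulNr addKr.
Qed.

Lemma lucasz_rec (j : int) : lucasz j = lucasz (j - 1) + lucasz (j - 2).
Proof.
case: j => [[|[|n]]|n] //.
- have -> : n.+2%:Z - 1 = n.+1%:Z by rewrite -[n.+2]addn1 PoszD addrK.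
  have -> : n.+2%:Z - 2 = n%:Z by rewrite -[n.+2]addn2 PoszD addrK.
  by rewrite -PoszD.
have -> : Negz n - 1 = Negz n.+1.
  by rewrite !NegzE -[n.+2]addn1 PoszD -opprD.
have -> : Negz n - 2 = Negz n.+2.
  by rewrite !NegzE -[n.+3]addn2 PoszD -opprD.
rewrite /lucasz -[lucas n.+3]/(lucas n.+2 + lucas n.+1)%N PoszD.
by rewrite !exprS !mulN1r !opprK mulrDr !mulNr addNKr.
Qed.

(* Main.v *)
(** The operators x = E^2, y = E^-1 (resp. x = -E, y = E^-2), with E the index
    shift on a Fibonacci-like sequence, satisfy x^-1 + y^-1 = 2, so that each
    left-hand side is a sum S_n of x^j y^(n-j) / 'C(n, j).  Expanding
    2 S_n = (x^-1 + y^-1) S_n and pairing neighbouring terms by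
    1/'C(n+1, j) + 1/'C(n+1, j+1) = (n+2)/(n+1) / 'C(n, j) gives
    2 S_(n+1) = x^(n+1) y^-1 + x^-1 y^(n+1) + (n+2)/(n+1) S_n,
    which the right-hand side satisfies as well. *)
Require Import Defs.
From mathcomp Require Import all_boot all_order all_algebra.
From mathcomp Require Import ring zify.

Import GRing.Theory Num.Theory.
Local Open Scope ring_scope.

(** Both binomials divide [n.+1 * 'C(n, j)], with cofactors [n.+1 - j] and [j.+1]; over that common
    denominator the numerators add up to [n.+2]. *)
Lemma invf_bin_add (F : numFieldType) (n j : nat) : (j <= n)%N ->
  'C(n.+1, j.+1)%:R^-1 + 'C(n.+1, j)%:R^-1
    = n.+2%:R / n.+1%:R / 'C(n, j)%:R :> F.
Proof.
move=> le_jn.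
have nz m : m.+1%:R != 0 :> F by rewrite pnatr_eq0.
have binnz m k : (k <= m)%N -> 'C(m, k)%:R != 0 :> F.
  by move=> le_km; rewrite pnatr_eq0 -lt0n bin_gt0.
have el : (n.+1 - j)%:R * 'C(n.+1, j)%:R = n.+1%:R * 'C(n, j)%:R :> F.
  by rewrite -!natrM mul_bin_down.
have er : j.+1%:R * 'C(n.+1, j.+1)%:R = n.+1%:R * 'C(n, j)%:R :> F.
  by rewrite -!natrM mul_bin_diag.
have invE (c d : F) : d != 0 -> c * d = n.+1%:R * 'C(n, j)%:R ->
    d^-1 = c / (n.+1%:R * 'C(n, j)%:R).
  move=> d0 cd.
  have cd0 : c * d != 0 by rewrite cd mulf_neq0 ?binnz.
  rewrite -cd invfM mulrA divff ?mul1r //.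
  by apply: contraNneq cd0 => ->; rewrite mul0r.
rewrite (invE _ _ (binnz _ _ (leqW le_jn)) el).
rewrite (invE _ _ (binnz n.+1 j.+1 le_jn) er) -mulrDl -natrD.
have -> : (j.+1 + (n.+1 - j) = n.+2)%N by lia.
by rewrite invfM mulrA.
Qed.

(* [a p q] stands for x^p y^q, and the hypothesis for x^-1 + y^-1 = 2. *)
Lemma sum_inv_bin (F : numFieldType) (a : int -> int -> F) :
  (forall p q, a (p - 1) q + a p (q - 1) = 2 * a p q) ->
  forall n : nat,
  \sum_(0 <= j < n.+1) a j%:Z (n%:Z - j%:Z) / 'C(n, j)%:R
    = n.+1%:R / 2 ^+ n.+1 *
      \sum_(0 <= j < n.+1) 2 ^+ j / j.+1%:R * (a j%:Z (-1) + a (-1) j%:Z).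
Proof.
move=> arec.
have n2 : 2 != 0 :> F by rewrite pnatr_eq0.
have nz m : m.+1%:R != 0 :> F by rewrite pnatr_eq0.
elim=> [|n IHn].
  rewrite !big_nat1 bin0 subrr expr0 addrC.
  have /= := arec 0 0; rewrite !sub0r => ->.
  by rewrite expr1 !divr1 !mul1r mulKf.
set S := LHS.
have SE : 2 * S = a n.+1%:Z (-1) + a (-1) n.+1%:Z
    + n.+2%:R / n.+1%:R * \sum_(0 <= j < n.+1) a j%:Z (n%:Z - j%:Z) / 'C(n, j)%:R.
  rewrite /S mulr_sumr.
  under eq_bigr => j _ do rewrite mulrA -arec mulrDl.
  (* The first term of one half and the last of the other are the boundary terms [a (-1) n.+1] and
     [a n.+1 (-1)]. Shifting the first half by one makes both interiors run over [a j (n - j)]. *)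
  rewrite big_split big_nat_recl // [X in _ + X = _]big_nat_recr //.
  rewrite bin0 binn !divr1 subrr !sub0r subr0.
  rewrite mulr_sumr [X in _ + X = _]addrC addrACA [X in X + _ = _]addrC.
  congr (_ + _).
  rewrite -big_split; apply: eq_big_nat => j /andP[_ le_jn].
  have -> : j.+1%:Z - 1 = j%:Z by lia.
  have -> : n.+1%:Z - j.+1%:Z = n%:Z - j%:Z by lia.
  have -> : n.+1%:Z - j%:Z - 1 = n%:Z - j%:Z by lia.
  by rewrite -[LHS]mulrDr invf_bin_add // mulrCA.
(* In twice the right-hand side, the top term has coefficient 2 * (n+2)/2^(n+2) * 2^(n+1)/(n+2) = 1,
   matching the boundary terms. *)
apply: (mulfI n2); rewrite SE IHn [in RHS]big_nat_recr //=.
set T := \sum_(0 <= j < n.+1) _; set b := a _ _ + _.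
rewrite [2 ^+ n.+2]exprS.
by field; rewrite -[2 + _]natrD nat1r !nz expf_neq0.
Qed.

Section FibonacciLike.

Variables (F : numFieldType) (G : int -> F).
Hypothesis Grec : forall j, G j = G (j - 1) + G (j - 2).

(** This is x^-1 + y^-1 = 2 for x = E^2, y = E^-1. *)
Lemma fiblike_pred2_add_succ (t : int) : G (t - 2) + G (t + 1) = 2 * G t.
Proof.
rewrite (Grec (t + 1)) addrK.
have -> : t + 1 - 2 = t - 1 by lia.
by rewrite addrCA [G (t - 2) + _]addrC -Grec mulr2n mulrDl mul1r.
Qed.

(** This is x^-1 + y^-1 = 2 for x = -E, y = E^-2; it follows from the previous identity at
    [t + 1]. *)
Lemma fiblike_succ2_sub_pred (t : int) : G (t + 2) - G (t - 1) = 2 * G t.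
Proof.
have := fiblike_pred2_add_succ (t + 1).
have -> : t + 1 - 2 = t - 1 by lia.
have -> : t + 1 + 1 = t + 2 by lia.
rewrite (Grec (t + 1)) addrK.
have -> : t + 1 - 2 = t - 1 by lia.
by move=> /(canRL (addKr _)) ->; ring.
Qed.

Lemma sum_fiblike_inv_bin (n : nat) (s : int) :
  \sum_(0 <= j < n.+1) G (3 * j%:Z + s - n%:Z) / 'C(n, j)%:R
    = n.+1%:R / 2 ^+ n.+1 *
      \sum_(0 <= j < n.+1)
        2 ^+ j / j.+1%:R * (G (s + 2 * j%:Z + 1) + G (s - j%:Z - 2)).
Proof.
pose a p q := G (2 * p - q + s).
have arec p q : a (p - 1) q + a p (q - 1) = 2 * a p q.
  by rewrite -fiblike_pred2_add_succ; congr (G _ + G _); lia.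
transitivity (\sum_(0 <= j < n.+1) a j%:Z (n%:Z - j%:Z) / 'C(n, j)%:R).
  by apply: eq_bigr => j _; congr (G _ / _); lia.
rewrite (sum_inv_bin _ _ arec); congr (_ * _).
by apply: eq_bigr => j _; congr (_ * (G _ + G _)); lia.
Qed.

Lemma sum_alt_fiblike_inv_bin (n : nat) (s : int) :
  \sum_(0 <= j < n.+1) (-1) ^+ j * G (3 * j%:Z + s - 2 * n%:Z) / 'C(n, j)%:R
    = n.+1%:R / 2 ^+ n.+1 *
      \sum_(0 <= j < n.+1)
        2 ^+ j * (-1) ^+ j / j.+1%:R *
        (G (s + j%:Z + 2) + (-1) ^ (j%:Z - 1) * G (s - 2 * j%:Z - 1)).
Proof.
have n1 : -1 != 0 :> F by rewrite oppr_eq0 oner_eq0.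
(* The sign is an integer power because [p] also takes the value -1. *)
pose a (p q : int) := (-1) ^ p * G (p - 2 * q + s).
have signB1 (p : int) : (-1) ^ (p - 1) = - (-1) ^ p :> F.
  by rewrite expfzDr // exprN1 invrN1 mulrN1.
have arec p q : a (p - 1) q + a p (q - 1) = 2 * a p q.
  rewrite /a signB1 mulrCA -fiblike_succ2_sub_pred [RHS]mulrBr mulNr addrC.
  by congr (_ * G _ - _ * G _); lia.
transitivity (\sum_(0 <= j < n.+1) a j%:Z (n%:Z - j%:Z) / 'C(n, j)%:R).
  by apply: eq_bigr => j _; congr (_ * G _ / _); lia.
rewrite (sum_inv_bin _ _ arec); congr (_ * _).
(* The second term of [a] carries the constant sign -1, which equals (-1)^j (-1)^(j-1), the product
   of the two signs in the statement. *)
apply: eq_bigr => j _; rewrite /a signB1 -exprnP exprN1 invrN1.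
have -> : j%:Z - 2 * -1 + s = s + j%:Z + 2 by lia.
have -> : -1 - 2 * j%:Z + s = s - 2 * j%:Z - 1 by lia.
rewrite -[2 ^+ j * _ / _]mulrA [(-1) ^+ j / _]mulrC mulrA -[RHS]mulrA.
by rewrite mulN1r [in RHS]mulrDr mulNr mulrN mulrA -expr2 sqrr_sign mul1r.
Qed.

End FibonacciLike.

Lemma Fq_rec (j : int) : Fq j = Fq (j - 1) + Fq (j - 2).
Proof. by rewrite /Fq fibz_rec rmorphD. Qed.

Lemma Lq_rec (j : int) : Lq j = Lq (j - 1) + Lq (j - 2).
Proof. by rewrite /Lq lucasz_rec rmorphD. Qed.

Theorem theorem4 (n : nat) (s : int) :
  [/\ \sum_(0 <= j < n.+1) Fq (3 * j%:Z + s - n%:Z) / 'C(n, j)%:R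
      = n.+1%:R / 2 ^+ n.+1 *
        \sum_(0 <= j < n.+1)
          2 ^+ j / j.+1%:R * (Fq (s + 2 * j%:Z + 1) + Fq (s - j%:Z - 2)),

      \sum_(0 <= j < n.+1) Lq (3 * j%:Z + s - n%:Z) / 'C(n, j)%:R
      = n.+1%:R / 2 ^+ n.+1 *
        \sum_(0 <= j < n.+1)
          2 ^+ j / j.+1%:R * (Lq (s + 2 * j%:Z + 1) + Lq (s - j%:Z - 2)),

      \sum_(0 <= j < n.+1)
        (-1) ^+ j * Fq (3 * j%:Z + s - 2 * n%:Z) / 'C(n, j)%:R
      = n.+1%:R / 2 ^+ n.+1 *
        \sum_(0 <= j < n.+1)
          2 ^+ j * (-1) ^+ j / j.+1%:R *
          (Fq (s + j%:Z + 2) + (-1) ^ (j%:Z - 1) * Fq (s - 2 * j%:Z - 1))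
    & \sum_(0 <= j < n.+1)
        (-1) ^+ j * Lq (3 * j%:Z + s - 2 * n%:Z) / 'C(n, j)%:R
      = n.+1%:R / 2 ^+ n.+1 *
        \sum_(0 <= j < n.+1)
          2 ^+ j * (-1) ^+ j / j.+1%:R *
          (Lq (s + j%:Z + 2) + (-1) ^ (j%:Z - 1) * Lq (s - 2 * j%:Z - 1))].
Proof.
split.
- exact: sum_fiblike_inv_bin Fq_rec n s.
- exact: sum_fiblike_inv_bin Lq_rec n s.
- exact: sum_alt_fiblike_inv_bin Fq_rec n s.
- exact: sum_alt_fiblike_inv_bin Lq_rec n s.
Qed.
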